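(* Let $r$ be an even integer, $n$ a positive integer and $m$ a non-negative integer, and let $\alpha=(1+\sqrt5)/2$. Then \[ \begin{split} \frac{( - 1)^n }{n}\sum_{j = m}^\infty \frac{F_{r(n + j)}}{L_r^{n + j} \binom{n + j}j} &= \sum_{j = 1}^{n - 1} \binom{n - 1}j\frac{( - 1)^j F_{r(n - j - 1)}}{jL_r^{n - j - 1} \binom{m + j}j} - \sum_{j = 1}^m \binom mj\frac{( - 1)^j F_{r(n + j - 1)}}{jL_r^{n + j - 1} \binom{n - 1 + j}j}\\ &\qquad+ \frac{F_{r(n - 1)}}{L_r^{n - 1}}\sum_{j = m + 1}^{n - 1} \frac{1}{j} + \frac{1}{L_r^{n - 1}}\left( F_{r(n - 1)} \log L_r - \frac{rL_{r(n - 1)}}{\sqrt 5 }\log \alpha \right), \end{split} \] and \[ \begin{split} \frac{( - 1)^{n - 1} }{n}\sum_{j = m}^\infty \frac{L_{r(n + j)}}{L_r^{n + j} \binom{n + j}j} &= \sum_{j = 1}^{n - 1} \binom{n - 1}j\frac{( - 1)^j L_{r(n - j - 1)}}{jL_r^{n - j - 1} \binom{m + j}j} - \sum_{j = 1}^m \binom mj\frac{( - 1)^j L_{r(n + j - 1)}}{jL_r^{n + j - 1} \binom{n - 1 + j}j}\\ &\qquad+ \frac{L_{r(n - 1)}}{L_r^{n - 1}}\sum_{j = m + 1}^{n - 1} \frac{1}{j} + \frac{1}{L_r^{n - 1}}\left( L_{r(n - 1)} \log L_r - rF_{r(n - 1)}\sqrt 5 \log \alpha \right). \end{split} \]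
   Context: $F_j$ and $L_j$ denote the Fibonacci and Lucas numbers, defined for all integers $j$ by $F_0=0$, $F_1=1$, $L_0=2$, $L_1=1$, $F_j=F_{j-1}+F_{j-2}$, $L_j=L_{j-1}+L_{j-2}$, extended to negative indices by $F_{-j}=(-1)^{j-1}F_j$, $L_{-j}=(-1)^jL_j$; equivalently $F_j=(\alpha^j-\beta^j)/\sqrt5$, $L_j=\alpha^j+\beta^j$ with $\beta=(1-\sqrt5)/2$. $\log$ is the natural logarithm. Sums $\sum_{j=1}^{0}$ are zero, and $\sum_{j=m+1}^{n-1}\frac1j$ denotes $H_{n-1}-H_m$ where $H_k=\sum_{i=1}^k\frac1i$ (so it is the ordinary sum when $m\le n-1$ and equals $-\sum_{j=n}^{m}\frac1j$ when $m\ge n$). *)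

(* Defs.v *)
From Stdlib Require Import Reals ZArith.
From Coquelicot Require Import Coquelicot.

Fixpoint fib_nat (n : nat) : Z :=
  match n with
  | 0%nat => 0%Z
  | S p => match p with
           | 0%nat => 1%Z
           | S q => (fib_nat p + fib_nat q)%Z
           end
  end.

Fixpoint lucas_nat (n : nat) : Z :=
  match n with
  | 0%nat => 2%Z
  | S p => match p with
           | 0%nat => 1%Z
           | S q => (lucas_nat p + lucas_nat q)%Z
           end
  end.

Definition fib (j : Z) : Z :=
  if (0 <=? j)%Z then fib_nat (Z.to_nat j)
  else ((-1) ^ (- j - 1) * fib_nat (Z.to_nat (- j)))%Z.

Definition lucas (j : Z) : Z :=
  if (0 <=? j)%Z then lucas_nat (Z.to_nat j)
  else ((-1) ^ (- j) * lucas_nat (Z.to_nat (- j)))%Z.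

Definition F (j : Z) : R := IZR (fib j).
Definition L (j : Z) : R := IZR (lucas j).

(* The name [C] alone denotes Coquelicot's complex numbers.  The quotient of
   factorials [Binomial.C n k] is the binomial coefficient only for k <= n. *)
Definition binom (n k : nat) : R := Binomial.C n k.

(* [sum_n_m a 1 k] is zero when k = 0. *)
Definition H (k : nat) : R := sum_n_m (fun i => / INR i)%R 1 k.

Definition golden : R := ((1 + sqrt 5) / 2)%R.

(* Main.v *)
(** For even [r] put [a = alpha^r] and [b = alpha^(-r)], so that [L_r = a + b], and
    [F_(rk)] and [L_(rk)] are combinations of [a^k] and [b^k].  Since
    [1 / (n binom(n+j, j))] is the Beta value [B(n, j+1)], both series are
    combinations of [sum_(j >= m) B(n, j+1) z^(n+j)] at [z = a / (a + b)] and
    [z = b / (a + b)], two points exchanged by [z -> 1 - z].  In terms of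
    [w = 1 - z] this sum is, up to sign, a finite sum over the powers of [w] minus
    [w^(n-1) ln w].  The finite sum makes sense for any sequence in place of the
    powers of [w]: raising [m] by one subtracts a multiple of the binomial transform
    of the sequence, and reading the sequence backwards exchanges [m] and [n - 1],
    so raising [n] acts in the same way.  The series obeys the same two recurrences,
    one by dropping its first term and the other because
    [B(n+1, j+1) = B(n, j+1) - B(n, j+2)]; for [n = 1] and [m = 0] it is the series
    of [- ln (1 - z)]. *)

Require Import Defs.
From Stdlib Require Import Reals ZArith Lra Lia.
From Coquelicot Require Import Coquelicot.
Open Scope R_scope.

(* Coquelicot's generic lemmas state equalities in the carrier of an algebraic
   structure on [R], which [ring] and [field] do not recognise. *)
Ltac eq_in_R := match goal with |- ?a = ?b => change (@eq R a b) end.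

Lemma sum_n_m_lin (s t : R) (u v w : nat -> R) (n m : nat)
  (huvw : forall k, (n <= k <= m)%nat -> u k = s * v k + t * w k) :
  sum_n_m u n m = s * sum_n_m v n m + t * sum_n_m w n m.
Proof.
  rewrite <- (sum_n_m_mult_l (K := R_Ring) s v), <- (sum_n_m_mult_l (K := R_Ring) t w).
  rewrite <- (sum_n_m_plus (G := R_AbelianMonoid)).
  now apply sum_n_m_ext_loc.
Qed.

Lemma sum_n_m_1_S (u : nat -> R) (n : nat) :
  sum_n_m u 1 (S n) = sum_n_m u 1 n + u (S n).
Proof. apply (sum_n_Sm u). lia. Qed.

Lemma sum_n_m_1_0 (u : nat -> R) : sum_n_m u 1 0 = 0.
Proof. apply (sum_n_m_zero u). lia. Qed.

Lemma sum_f_R0_around (u : nat -> R) (p q : nat) :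
  sum_f_R0 u (p + q)
  = sum_n_m (fun j => u (p - j)%nat) 1 p + u p + sum_n_m (fun j => u (p + j)%nat) 1 q.
Proof.
  induction q as [|q IHq].
  - rewrite Nat.add_0_r, sum_n_m_1_0, <- sum_f_R0_skip, <- sum_n_Reals.
    unfold sum_n. rewrite sum_Sn_m by lia.
    change plus with Rplus. cbn beta. rewrite Nat.sub_0_r. ring.
  - rewrite Nat.add_succ_r, tech5, IHq, sum_n_m_1_S, Nat.add_succ_r. ring.
Qed.

Lemma pow_opp (x : R) (n : nat) : (- x) ^ n = (-1) ^ n * x ^ n.
Proof. rewrite <- Rpow_mult_distr. f_equal. ring. Qed.

Lemma pow_m1_square (n : nat) : (-1) ^ n * (-1) ^ n = 1.
Proof. rewrite <- pow_opp. replace (- (-1)) with 1 by ring. apply pow1. Qed.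

Lemma pow_m1_add (n k : nat) : (-1) ^ n * (-1) ^ (n + k) = (-1) ^ k.
Proof. rewrite pow_add, <- Rmult_assoc, pow_m1_square. ring. Qed.

Lemma pow_m1_sub (n k : nat) (hkn : (k <= n)%nat) : (-1) ^ n * (-1) ^ (n - k) = (-1) ^ k.
Proof.
  rewrite <- (Nat.sub_add k n hkn) at 1.
  now rewrite Rmult_comm, pow_m1_add.
Qed.

(** * Binomial and Beta coefficients *)

Lemma INR_fact_S (n : nat) : INR (fact (S n)) = (INR n + 1) * INR (fact n).
Proof. now rewrite fact_simpl, mult_INR, S_INR. Qed.

Lemma binom_add_r (n k : nat) :
  binom (n + k) k = INR (fact (n + k)) / (INR (fact k) * INR (fact n)).
Proof. unfold binom, Binomial.C. now rewrite Nat.add_sub. Qed.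

Lemma binom_sym (n k : nat) (hkn : (k <= n)%nat) : binom n (n - k) = binom n k.
Proof. symmetry. now apply pascal_step1. Qed.

Lemma binom_add_l (n k : nat) :
  binom (n + k) n = INR (fact (n + k)) / (INR (fact n) * INR (fact k)).
Proof. rewrite Nat.add_comm. apply binom_add_r. Qed.

Lemma binom_neq_0 (n k : nat) : binom n k <> 0.
Proof.
  unfold binom, Binomial.C. apply Rmult_integral_contrapositive. split.
  - apply INR_fact_neq_0.
  - apply Rinv_neq_0_compat, Rmult_integral_contrapositive.
    split; apply INR_fact_neq_0.
Qed.

Ltac field_fact :=
  repeat match goal with
  | |- context [INR (fact ?n)] =>
      lazymatch goal with
      | _ : INR (fact n) <> 0 |- _ => fail
      | _ => pose proof (INR_fact_neq_0 n)
      end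
  end;
  repeat match goal with
  | |- context [INR ?n] =>
      lazymatch goal with
      | _ : 0 <= INR n |- _ => fail
      | _ => pose proof (pos_INR n)
      end
  end;
  field; repeat split; try assumption; lra.

(* Euler's [B(p + 1, j + 1)]. *)
Definition beta_coef (p j : nat) : R :=
  INR (fact p) * INR (fact j) / INR (fact (p + S j)).

Lemma beta_coef_sym (p j : nat) : beta_coef p j = beta_coef j p.
Proof.
  unfold beta_coef. replace (j + S p)%nat with (p + S j)%nat by lia.
  now rewrite (Rmult_comm (INR (fact j))).
Qed.

Lemma beta_coef_S_l (p j : nat) :
  beta_coef (S p) j = beta_coef p j - beta_coef p (S j).
Proof.
  unfold beta_coef.
  rewrite Nat.add_succ_l, (Nat.add_succ_r p (S j)), !INR_fact_S, plus_INR, S_INR.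
  field_fact.
Qed.

Lemma beta_coef_0_l (j : nat) : beta_coef 0 j = / INR (S j).
Proof.
  unfold beta_coef. rewrite Nat.add_0_l, INR_fact_S, S_INR. simpl (INR (fact 0)).
  field_fact.
Qed.

Lemma beta_coef_binom_r (p j : nat) :
  beta_coef p j = / (INR (S j) * binom (p + S j) (S j)).
Proof.
  unfold beta_coef. rewrite binom_add_r, INR_fact_S, S_INR. field_fact.
Qed.

Lemma beta_coef_binom_l (p j : nat) :
  beta_coef p j = / (INR (S p) * binom (S p + j) j).
Proof.
  rewrite beta_coef_sym, beta_coef_binom_r, (Nat.add_comm j), <- binom_sym by lia.
  now rewrite Nat.add_comm, Nat.add_sub.
Qed.

Lemma binom_quot_S_r (p m j : nat) (hj : (1 <= j <= p)%nat) :
  binom p j / (INR j * binom (S m + j) j)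
  = binom p j / (INR j * binom (m + j) j)
    - beta_coef p m * binom (p + S m) (p - j).
Proof.
  destruct (Nat.le_exists_sub j p) as [q [-> _]]; [lia|].
  assert (INR j <> 0) by (apply not_0_INR; lia).
  rewrite Nat.add_sub. unfold beta_coef.
  replace (q + j + S m)%nat with (q + (S m + j))%nat by lia.
  rewrite binom_add_l, !binom_add_r, Nat.add_succ_l, !INR_fact_S, plus_INR.
  field_fact.
Qed.

Lemma binom_quot_S_l (p m j : nat) (hj : (1 <= j <= m)%nat) :
  binom (S m) j / (INR j * binom (p + j) j)
  = binom m j / (INR j * binom (p + j) j)
    + beta_coef p m * binom (p + S m) (p + j).
Proof.
  destruct (Nat.le_exists_sub j m) as [q [-> _]]; [lia|].
  assert (INR j <> 0) by (apply not_0_INR; lia).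
  unfold beta_coef.
  replace (p + S (q + j))%nat with (p + j + S q)%nat by lia.
  rewrite <- Nat.add_succ_l.
  rewrite binom_add_l, !binom_add_r, Nat.add_succ_l, !INR_fact_S, plus_INR.
  field_fact.
Qed.

(** * The finite sum and the binomial transform *)

Definition binomial_term (u : nat -> R) (n i : nat) : R := binom n i * ((-1) ^ i * u i).

Definition binomial_transform (u : nat -> R) (n : nat) : R :=
  sum_f_R0 (binomial_term u n) n.

Lemma binomial_transform_pow (w : R) (n : nat) :
  binomial_transform (pow w) n = (1 - w) ^ n.
Proof.
  replace (1 - w) with (- w + 1) by ring. rewrite binomial.
  apply sum_eq. intros i _. now rewrite pow1, Rmult_1_r, pow_opp.
Qed.

Lemma binomial_transform_rev (u : nat -> R) (n : nat) :
  binomial_transform (fun i => u (n - i)%nat) n = (-1) ^ n * binomial_transform u n.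
Proof.
  unfold binomial_transform. rewrite <- sum_f_R0_skip, scal_sum.
  apply sum_eq. intros i Hi. unfold binomial_term.
  rewrite binom_sym, <- (pow_m1_sub n (n - i)) by lia.
  replace (n - (n - i))%nat with i by lia. ring.
Qed.

Definition inv_binom_sum_below (u : nat -> R) (p m : nat) : R :=
  sum_n_m (fun j => binom p j * ((-1) ^ j * u (p - j)%nat / (INR j * binom (m + j) j))) 1 p.

Definition inv_binom_sum_above (u : nat -> R) (p m : nat) : R :=
  sum_n_m (fun j => binom m j * ((-1) ^ j * u (p + j)%nat / (INR j * binom (p + j) j))) 1 m.

(* With [p = n - 1] and [u k = F_(rk) / L_r^k] this is the right-hand side of the
   theorem without its logarithms. *)
Definition inv_binom_sum (u : nat -> R) (p m : nat) : R :=
  inv_binom_sum_below u p m - inv_binom_sum_above u p m + u p * (H p - H m).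

Lemma inv_binom_sum_ext (u v : nat -> R) (p m : nat)
  (huv : forall k, (k <= p + m)%nat -> u k = v k) :
  inv_binom_sum u p m = inv_binom_sum v p m.
Proof.
  assert (Ebelow : inv_binom_sum_below u p m = inv_binom_sum_below v p m).
  { apply sum_n_m_ext_loc. intros j Hj. now rewrite huv by lia. }
  assert (Eabove : inv_binom_sum_above u p m = inv_binom_sum_above v p m).
  { apply sum_n_m_ext_loc. intros j Hj. now rewrite huv by lia. }
  unfold inv_binom_sum. now rewrite Ebelow, Eabove, huv by lia.
Qed.

Lemma inv_binom_sum_lin (s t : R) (u v : nat -> R) (p m : nat) :
  inv_binom_sum (fun k => s * u k + t * v k) p m
  = s * inv_binom_sum u p m + t * inv_binom_sum v p m.
Proof.
  assert (Ebelow : inv_binom_sum_below (fun k => s * u k + t * v k) p m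
      = s * inv_binom_sum_below u p m + t * inv_binom_sum_below v p m).
  { apply sum_n_m_lin. intros j _. unfold Rdiv. ring. }
  assert (Eabove : inv_binom_sum_above (fun k => s * u k + t * v k) p m
      = s * inv_binom_sum_above u p m + t * inv_binom_sum_above v p m).
  { apply sum_n_m_lin. intros j _. unfold Rdiv. ring. }
  unfold inv_binom_sum. rewrite Ebelow, Eabove. ring.
Qed.

Lemma inv_binom_sum_scal (s : R) (u : nat -> R) (p m : nat) :
  inv_binom_sum (fun k => s * u k) p m = s * inv_binom_sum u p m.
Proof.
  rewrite (inv_binom_sum_ext _ (fun k => s * u k + 0 * u k)) by (intros; ring).
  rewrite inv_binom_sum_lin. ring.
Qed.

Lemma inv_binom_sum_rev (u : nat -> R) (p m : nat) :
  inv_binom_sum (fun k => u (p + m - k)%nat) m p = - inv_binom_sum u p m.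
Proof.
  assert (Ebelow : inv_binom_sum_below (fun k => u (p + m - k)%nat) m p
      = inv_binom_sum_above u p m).
  { apply sum_n_m_ext_loc. intros j Hj.
    now replace (p + m - (m - j))%nat with (p + j)%nat by lia. }
  assert (Eabove : inv_binom_sum_above (fun k => u (p + m - k)%nat) m p
      = inv_binom_sum_below u p m).
  { apply sum_n_m_ext_loc. intros j Hj.
    now replace (p + m - (m + j))%nat with (p - j)%nat by lia. }
  unfold inv_binom_sum. rewrite Ebelow, Eabove, Nat.add_sub. ring.
Qed.

Lemma inv_binom_sum_below_S_r (u : nat -> R) (p m : nat) :
  inv_binom_sum_below u p (S m)
  = inv_binom_sum_below u p m
    - (-1) ^ p * beta_coef p m
      * sum_n_m (fun j => binomial_term u (p + S m) (p - j)) 1 p.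
Proof.
  unfold inv_binom_sum_below.
  rewrite (sum_n_m_lin 1 (- ((-1) ^ p * beta_coef p m)) _ (fun j => binom p j
    * ((-1) ^ j * u (p - j)%nat / (INR j * binom (m + j) j)))
    (fun j => binomial_term u (p + S m) (p - j))); [ring|].
  intros j Hj. pose proof (binom_quot_S_r p m j Hj) as Equot.
  unfold binomial_term. rewrite <- (pow_m1_sub p j) by lia.
  transitivity ((-1) ^ p * (-1) ^ (p - j) * u (p - j)%nat
    * (binom p j / (INR j * binom (S m + j) j))); [unfold Rdiv; ring|].
  rewrite Equot. unfold Rdiv. ring.
Qed.

Lemma inv_binom_sum_above_S_r (u : nat -> R) (p m : nat) :
  inv_binom_sum_above u p (S m)
  = inv_binom_sum_above u p m
    + (-1) ^ p * beta_coef p m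
      * sum_n_m (fun j => binomial_term u (p + S m) (p + j)) 1 (S m).
Proof.
  unfold inv_binom_sum_above. rewrite !sum_n_m_1_S.
  rewrite (sum_n_m_lin 1 ((-1) ^ p * beta_coef p m) _ (fun j => binom m j
    * ((-1) ^ j * u (p + j)%nat / (INR j * binom (p + j) j)))
    (fun j => binomial_term u (p + S m) (p + j))).
  - assert (Elast : binom (S m) (S m)
        * ((-1) ^ S m * u (p + S m)%nat / (INR (S m) * binom (p + S m) (S m)))
        = (-1) ^ p * beta_coef p m * binomial_term u (p + S m) (p + S m)).
    { unfold binomial_term. rewrite <- (pow_m1_add p (S m)), beta_coef_binom_r.
      unfold binom at 1 4. rewrite !C_n_n. unfold Rdiv. ring. }
    rewrite Elast. ring.
  - intros j Hj. pose proof (binom_quot_S_l p m j Hj) as Equot.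
    unfold binomial_term. rewrite <- (pow_m1_add p j).
    transitivity ((-1) ^ p * (-1) ^ (p + j) * u (p + j)%nat
      * (binom (S m) j / (INR j * binom (p + j) j))); [unfold Rdiv; ring|].
    rewrite Equot. unfold Rdiv. ring.
Qed.

Lemma inv_binom_sum_S_r (u : nat -> R) (p m : nat) :
  inv_binom_sum u p (S m)
  = inv_binom_sum u p m
    - (-1) ^ p * beta_coef p m * binomial_transform u (p + S m).
Proof.
  assert (Ecenter : (-1) ^ p * beta_coef p m * binomial_term u (p + S m) p
      = u p * / INR (S m)).
  { unfold binomial_term. rewrite <- (binom_sym _ p) by lia.
    replace (p + S m - p)%nat with (S m) by lia. rewrite beta_coef_binom_r.
    pose proof (binom_neq_0 (p + S m) (S m)).
    assert (INR (S m) <> 0) by (apply not_0_INR; lia).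
    transitivity ((-1) ^ p * (-1) ^ p * (u p * / INR (S m))); [now field|].
    rewrite pow_m1_square. ring. }
  assert (EH : H (S m) = H m + / INR (S m)) by apply sum_n_m_1_S.
  unfold inv_binom_sum, binomial_transform.
  rewrite sum_f_R0_around, inv_binom_sum_below_S_r, inv_binom_sum_above_S_r, EH.
  rewrite !Rmult_plus_distr_l, Ecenter. ring.
Qed.

Lemma inv_binom_sum_S_l (u : nat -> R) (p m : nat) :
  inv_binom_sum u (S p) m
  = inv_binom_sum (fun k => u (S k)) p m
    - (-1) ^ p * beta_coef p m * binomial_transform u (p + S m).
Proof.
  set (v := fun k => u (p + S m - k)%nat).
  assert (Eu : inv_binom_sum u (S p) m = - inv_binom_sum v m (S p)).
  { rewrite <- (inv_binom_sum_rev v).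
    apply inv_binom_sum_ext. intros k Hk. unfold v. f_equal. lia. }
  assert (Eshift : inv_binom_sum (fun k => u (S k)) p m = - inv_binom_sum v m p).
  { rewrite <- (inv_binom_sum_rev v).
    apply inv_binom_sum_ext. intros k Hk. unfold v. f_equal. lia. }
  rewrite Eu, Eshift, inv_binom_sum_S_r, (beta_coef_sym m).
  replace (m + S p)%nat with (p + S m)%nat by lia.
  unfold v. rewrite (binomial_transform_rev u), <- (pow_m1_add m p).
  rewrite Nat.add_succ_r, (Nat.add_comm p). simpl. ring.
Qed.

(** * The series *)

Definition inv_binom_log_sum (w : R) (p m : nat) : R :=
  inv_binom_sum (pow w) p m - w ^ p * ln w.

Lemma inv_binom_log_sum_0_0 (w : R) : inv_binom_log_sum w 0 0 = - ln w.
Proof.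
  unfold inv_binom_log_sum, inv_binom_sum, inv_binom_sum_below, inv_binom_sum_above.
  rewrite !sum_n_m_1_0. simpl. ring.
Qed.

Lemma inv_binom_log_sum_S_r (w : R) (p m : nat) :
  inv_binom_log_sum w p (S m)
  = inv_binom_log_sum w p m - (-1) ^ p * beta_coef p m * (1 - w) ^ (p + S m).
Proof.
  unfold inv_binom_log_sum. rewrite inv_binom_sum_S_r, binomial_transform_pow. ring.
Qed.

Lemma inv_binom_log_sum_S_l (w : R) (p m : nat) :
  inv_binom_log_sum w (S p) m
  = w * inv_binom_log_sum w p m - (-1) ^ p * beta_coef p m * (1 - w) ^ (p + S m).
Proof.
  unfold inv_binom_log_sum. rewrite inv_binom_sum_S_l, binomial_transform_pow.
  rewrite (inv_binom_sum_scal w (pow w)). simpl. ring.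
Qed.

Lemma is_series_ln_one_minus (z : R) (hz : Rabs z < 1) :
  is_series (fun k => z ^ S k / INR (S k)) (- ln (1 - z)).
Proof.
  apply Rabs_def2 in hz as Hz.
  assert (Hradius : CV_radius (fun _ => 1) = 1).
  { rewrite (CV_radius_finite_DAlembert _ 1); [now rewrite Rinv_1|intros; lra|lra|].
    apply is_lim_seq_ext with (fun _ => 1); [|apply is_lim_seq_const].
    intros _. rewrite Rdiv_diag, Rabs_R1; lra. }
  assert (Hint : is_RInt (PSeries (fun _ => 1)) 0 z (- ln (1 - z))).
  { apply is_RInt_ext with (fun t => / (1 - t)).
    - intros t Ht. symmetry. apply is_pseries_unique, is_pseries_R.
      apply is_series_ext with (fun k => t ^ k); [intros k; eq_in_R; ring|].
      apply is_series_geom, Rabs_def1; revert Ht;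
        unfold Rmin, Rmax; destruct (Rle_dec 0 z); lra.
    - replace (- ln (1 - z)) with (minus (- ln (1 - z)) (- ln (1 - 0)))
        by (rewrite Rminus_0_r, ln_1; unfold minus, plus, opp; simpl; ring).
      apply (is_RInt_derive (fun t => - ln (1 - t))); intros t Ht;
        assert (t < 1) by (revert Ht; unfold Rmax; destruct (Rle_dec 0 z); lra).
      + auto_derive; [lra|field; lra].
      + apply (ex_derive_continuous (V := R_NormedModule) (fun t : R => / (1 - t))).
        auto_derive. lra. }
  assert (Hpser : is_pseries (PS_Int (fun _ => 1)) z (- ln (1 - z))).
  { rewrite <- (is_RInt_unique _ _ _ _ Hint). apply is_pseries_RInt.
    now rewrite Hradius. }
  apply is_pseries_R in Hpser.
  apply is_series_ext with (fun k => PS_Int (fun _ => 1) (S k) * z ^ S k).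
  { intros k. eq_in_R. unfold PS_Int, Rdiv. ring. }
  apply (is_series_incr_1 (fun k => PS_Int (fun _ => 1) k * z ^ k)).
  simpl (PS_Int _ 0). rewrite Rmult_0_l. change plus with Rplus. now rewrite Rplus_0_r.
Qed.

Lemma is_series_beta_coef_0_l (m : nat) (z : R) (hz : Rabs z < 1) :
  is_series (fun k => beta_coef 0 (m + k) * z ^ S (m + k))
    (inv_binom_log_sum (1 - z) 0 m).
Proof.
  induction m as [|m IHm].
  - rewrite inv_binom_log_sum_0_0.
    apply is_series_ext with (fun k => z ^ S k / INR (S k)).
    + intros k. eq_in_R. rewrite beta_coef_0_l, Nat.add_0_l. unfold Rdiv. ring.
    + now apply is_series_ln_one_minus.
  - apply is_series_ext with (fun k => beta_coef 0 (m + S k) * z ^ S (m + S k)).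
    { intros k. now rewrite Nat.add_succ_r. }
    apply (is_series_incr_1 (fun k => beta_coef 0 (m + k) * z ^ S (m + k))).
    change plus with Rplus. rewrite inv_binom_log_sum_S_r, Nat.add_0_r, Nat.add_0_l.
    replace (1 - (1 - z)) with z by ring. simpl ((-1) ^ 0).
    rewrite Rmult_1_l. unfold Rminus at 1. rewrite Rplus_assoc, Rplus_opp_l.
    now rewrite Rplus_0_r.
Qed.

Lemma is_series_beta_coef (p m : nat) (z : R) (hz : Rabs z < 1) :
  is_series (fun k => beta_coef p (m + k) * z ^ (p + S (m + k)))
    ((-1) ^ p * inv_binom_log_sum (1 - z) p m).
Proof.
  revert m. induction p as [|p IHp]; intros m.
  - rewrite Rmult_1_l. now apply is_series_beta_coef_0_l.
  - apply is_series_ext with (fun k => z * (beta_coef p (m + k) * z ^ (p + S (m + k)))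
        - beta_coef p (S m + k) * z ^ (p + S (S m + k))).
    { intros k. eq_in_R. rewrite beta_coef_S_l, !Nat.add_succ_l, (Nat.add_succ_r p (S _)).
      simpl. ring. }
    replace ((-1) ^ S p * inv_binom_log_sum (1 - z) (S p) m)
      with (z * ((-1) ^ p * inv_binom_log_sum (1 - z) p m)
            - (-1) ^ p * inv_binom_log_sum (1 - z) p (S m)).
    + apply (is_series_minus (V := R_NormedModule)); [|apply IHp].
      apply (is_series_scal (V := R_NormedModule)), IHp.
    + rewrite inv_binom_log_sum_S_l, inv_binom_log_sum_S_r. simpl. ring.
Qed.

(* Setting [x = a / (a + b)] and [y = b / (a + b)], the series at [x] closes on
    powers of [1 - x = y] and conversely, which exchanges [s] and [t]. *)
Lemma is_series_beta_coef_two_powers (a b s t : R) (p m : nat) (ha : 0 < a) (hb : 0 < b) :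
  is_series (fun k => beta_coef p (m + k)
      * ((s * a ^ (p + S (m + k)) + t * b ^ (p + S (m + k))) / (a + b) ^ (p + S (m + k))))
    ((-1) ^ p
     * (inv_binom_sum (fun k => (t * a ^ k + s * b ^ k) / (a + b) ^ k) p m
        + 1 / (a + b) ^ p * ((t * a ^ p + s * b ^ p) * ln (a + b)
                             - (t * a ^ p * ln a + s * b ^ p * ln b)))).
Proof.
  set (x := a / (a + b)). set (y := b / (a + b)).
  assert (Hxy : x + y = 1) by (unfold x, y; field; lra).
  assert (Hx : 0 < x) by (apply Rdiv_lt_0_compat; lra).
  assert (Hy : 0 < y) by (apply Rdiv_lt_0_compat; lra).
  assert (Hpow : forall s t k,
      (s * a ^ k + t * b ^ k) / (a + b) ^ k = s * x ^ k + t * y ^ k).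
  { intros. unfold x, y, Rdiv. rewrite !Rpow_mult_distr, pow_inv. ring. }
  apply is_series_ext with (fun k =>
    s * (beta_coef p (m + k) * x ^ (p + S (m + k)))
    + t * (beta_coef p (m + k) * y ^ (p + S (m + k)))).
  { intros k. eq_in_R. rewrite Hpow. ring. }
  replace ((-1) ^ p * _) with
    (s * ((-1) ^ p * inv_binom_log_sum (1 - x) p m)
     + t * ((-1) ^ p * inv_binom_log_sum (1 - y) p m)).
  - apply (is_series_plus (V := R_NormedModule));
      apply (is_series_scal (V := R_NormedModule)), is_series_beta_coef, Rabs_def1; lra.
  - rewrite (inv_binom_sum_ext _ _ p m (fun k _ => Hpow t s k)), inv_binom_sum_lin.
    replace (1 - x) with y by lra. replace (1 - y) with x by lra.
    assert (Elnx : ln x = ln a - ln (a + b)) by (apply ln_div; lra).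
    assert (Elny : ln y = ln b - ln (a + b)) by (apply ln_div; lra).
    unfold inv_binom_log_sum. rewrite Elnx, Elny.
    transitivity ((-1) ^ p * (t * inv_binom_sum (pow x) p m + s * inv_binom_sum (pow y) p m
      + ((t * x ^ p + s * y ^ p) * ln (a + b) - (t * x ^ p * ln a + s * y ^ p * ln b))));
      [ring|].
    unfold x at 2 3, y at 2 3, Rdiv. rewrite !Rpow_mult_distr, pow_inv. ring.
Qed.

Lemma ex_Series_scal_eq (u : nat -> R) (s t v : R) (hst : s * t = 1)
  (hu : is_series u (t * v)) : ex_series u /\ s * Series u = v.
Proof.
  split; [now exists (t * v)|].
  rewrite (is_series_unique _ _ hu), <- Rmult_assoc, hst. ring.
Qed.

Lemma Series_inv_binom_two_powers (num : nat -> R) (a b s eps : R) (n m : nat)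
  (ha : 0 < a) (hb : 0 < b) (heps : eps * eps = 1) (hn : (0 < n)%nat)
  (hnum : forall k, num k = s * (a ^ k + eps * b ^ k)) :
  ex_series (fun k => num (n + (m + k))%nat
      / ((a + b) ^ (n + (m + k)) * binom (n + (m + k)) (m + k)))
  /\ eps * (-1) ^ (n - 1) / INR n
     * Series (fun k => num (n + (m + k))%nat
         / ((a + b) ^ (n + (m + k)) * binom (n + (m + k)) (m + k)))
     = inv_binom_sum (fun k => num k / (a + b) ^ k) (n - 1) m
       + 1 / (a + b) ^ (n - 1)
         * (num (n - 1)%nat * ln (a + b)
            - s * (a ^ (n - 1) * ln a + eps * (b ^ (n - 1) * ln b))).
Proof.
  destruct n as [|p]; [lia|]. rewrite Nat.sub_succ, Nat.sub_0_r.
  assert (Hp : INR (S p) <> 0) by (apply not_0_INR; lia).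
  assert (Enum : forall k, s * eps * a ^ k + s * b ^ k = eps * num k).
  { intros k. rewrite hnum.
    transitivity (s * eps * a ^ k + s * (eps * eps) * b ^ k); [rewrite heps|]; ring. }
  apply ex_Series_scal_eq with (INR (S p) * (eps * (-1) ^ p)).
  { transitivity ((eps * eps) * ((-1) ^ p * (-1) ^ p)); [now field|].
    rewrite heps, pow_m1_square. ring. }
  apply is_series_ext with (fun k => INR (S p) * (beta_coef p (m + k)
    * ((s * a ^ (p + S (m + k)) + s * eps * b ^ (p + S (m + k)))
       / (a + b) ^ (p + S (m + k))))).
  { intros k. eq_in_R. rewrite hnum, beta_coef_binom_l, Nat.add_succ_r, !Nat.add_succ_l.
    pose proof (binom_neq_0 (S (p + (m + k))) (m + k)).
    assert ((a + b) ^ S (p + (m + k)) <> 0) by (apply pow_nonzero; lra).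
    field. auto. }
  rewrite Rmult_assoc. apply (is_series_scal (V := R_NormedModule)).
  replace (eps * (-1) ^ p * _) with ((-1) ^ p
    * (inv_binom_sum (fun k => (s * eps * a ^ k + s * b ^ k) / (a + b) ^ k) p m
       + 1 / (a + b) ^ p * ((s * eps * a ^ p + s * b ^ p) * ln (a + b)
                            - (s * eps * a ^ p * ln a + s * b ^ p * ln b))));
    [now apply is_series_beta_coef_two_powers|].
  rewrite (inv_binom_sum_ext _ (fun k => eps * (num k / (a + b) ^ k)))
    by (intros k _; rewrite Enum; unfold Rdiv; ring).
  rewrite inv_binom_sum_scal, Enum.
  replace (s * b ^ p * ln b) with (eps * eps * s * b ^ p * ln b) by (rewrite heps; ring).
  ring.
Qed.

Lemma inv_binom_sum_quot (num : nat -> R) (l : R) (n m : nat) (hn : (0 < n)%nat) :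
  inv_binom_sum (fun k => num k / l ^ k) (n - 1) m
  = sum_n_m (fun j => binom (n - 1) j * ((-1) ^ j * num (n - j - 1)%nat
        / (INR j * l ^ (n - j - 1) * binom (m + j) j))) 1 (n - 1)
    - sum_n_m (fun j => binom m j * ((-1) ^ j * num (n + j - 1)%nat
        / (INR j * l ^ (n + j - 1) * binom (n - 1 + j) j))) 1 m
    + num (n - 1)%nat / l ^ (n - 1) * (H (n - 1) - H m).
Proof.
  unfold inv_binom_sum. f_equal. f_equal; [|f_equal];
    apply sum_n_m_ext; intros j; eq_in_R.
  - replace (n - 1 - j)%nat with (n - j - 1)%nat by lia.
    unfold Rdiv. rewrite !Rinv_mult. ring.
  - replace (n + j - 1)%nat with (n - 1 + j)%nat by lia.
    unfold Rdiv. rewrite !Rinv_mult. ring.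
Qed.

(** * Binet's formulas *)

Definition golden_conj : R := (1 - sqrt 5) / 2.

Lemma sqrt5_pos : 0 < sqrt 5.
Proof. apply sqrt_lt_R0. lra. Qed.

Lemma sqrt5_sqr : sqrt 5 * sqrt 5 = 5.
Proof. apply sqrt_sqrt. lra. Qed.

Lemma golden_pos : 0 < golden.
Proof. pose proof sqrt5_pos. unfold golden. lra. Qed.

Lemma golden_sqr : golden * golden = golden + 1.
Proof. pose proof sqrt5_sqr. unfold golden. lra. Qed.

Lemma golden_conj_sqr : golden_conj * golden_conj = golden_conj + 1.
Proof. pose proof sqrt5_sqr. unfold golden_conj. lra. Qed.

Lemma Rinv_golden : / golden = - golden_conj.
Proof.
  pose proof golden_pos. apply Rmult_eq_reg_l with golden; [|lra].
  rewrite Rinv_r by lra. pose proof sqrt5_sqr. unfold golden, golden_conj. lra.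
Qed.

Lemma Rinv_golden_conj : / golden_conj = - golden.
Proof. rewrite <- (Rinv_inv golden), Rinv_golden, Rinv_opp. ring. Qed.

Lemma fib_rec_unique (u v : nat -> R)
  (hu : forall n, u (S (S n)) = u (S n) + u n)
  (hv : forall n, v (S (S n)) = v (S n) + v n)
  (h0 : u 0%nat = v 0%nat) (h1 : u 1%nat = v 1%nat) (n : nat) : u n = v n.
Proof.
  enough (E : u n = v n /\ u (S n) = v (S n)) by apply E.
  induction n as [|n [IHn IHSn]]; [now split|].
  split; [exact IHSn|]. now rewrite hu, hv, IHn, IHSn.
Qed.

Lemma pow_fib_rec (x : R) (hx : x * x = x + 1) (n : nat) :
  x ^ S (S n) = x ^ S n + x ^ n.
Proof. simpl. rewrite <- Rmult_assoc, hx. ring. Qed.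

Lemma fib_nat_binet (n : nat) :
  IZR (fib_nat n) = (golden ^ n - golden_conj ^ n) / sqrt 5.
Proof.
  pose proof sqrt5_pos. revert n.
  apply (fib_rec_unique (fun n => IZR (fib_nat n))
    (fun n => (golden ^ n - golden_conj ^ n) / sqrt 5)).
  - intros n. apply plus_IZR.
  - intros n. rewrite (pow_fib_rec _ golden_sqr), (pow_fib_rec _ golden_conj_sqr).
    field. lra.
  - simpl. field. lra.
  - unfold golden, golden_conj. simpl. field. lra.
Qed.

Lemma lucas_nat_binet (n : nat) :
  IZR (lucas_nat n) = golden ^ n + golden_conj ^ n.
Proof.
  revert n. apply (fib_rec_unique (fun n => IZR (lucas_nat n))
    (fun n => golden ^ n + golden_conj ^ n)).
  - intros n. apply plus_IZR.
  - intros n. rewrite (pow_fib_rec _ golden_sqr), (pow_fib_rec _ golden_conj_sqr). ring.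
  - simpl. ring.
  - unfold golden, golden_conj. simpl. field.
Qed.

Lemma powerRZ_golden_neg (n : nat) :
  powerRZ golden (- Z.of_nat n) = (-1) ^ n * golden_conj ^ n.
Proof. now rewrite powerRZ_neg', <- pow_powerRZ, <- pow_inv, Rinv_golden, pow_opp. Qed.

Lemma powerRZ_golden_conj_neg (n : nat) :
  powerRZ golden_conj (- Z.of_nat n) = (-1) ^ n * golden ^ n.
Proof. now rewrite powerRZ_neg', <- pow_powerRZ, <- pow_inv, Rinv_golden_conj, pow_opp. Qed.

Lemma Z_nat_or_neg_nat (j : Z) :
  exists n : nat, j = Z.of_nat n \/ j = (- Z.of_nat (S n))%Z.
Proof.
  destruct (Z_le_gt_dec 0 j).
  - exists (Z.to_nat j). lia.
  - exists (Z.to_nat (- j - 1)). lia.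
Qed.

Lemma F_of_nat (n : nat) : F (Z.of_nat n) = IZR (fib_nat n).
Proof.
  unfold F, fib. rewrite (proj2 (Z.leb_le 0 (Z.of_nat n))) by lia.
  now rewrite Nat2Z.id.
Qed.

Lemma L_of_nat (n : nat) : L (Z.of_nat n) = IZR (lucas_nat n).
Proof.
  unfold L, lucas. rewrite (proj2 (Z.leb_le 0 (Z.of_nat n))) by lia.
  now rewrite Nat2Z.id.
Qed.

Lemma F_neg_S (n : nat) : F (- Z.of_nat (S n)) = (-1) ^ n * IZR (fib_nat (S n)).
Proof.
  unfold F, fib. rewrite (proj2 (Z.leb_gt 0 (- Z.of_nat (S n)))) by lia.
  rewrite Z.opp_involutive, Nat2Z.id, mult_IZR, pow_IZR.
  now replace (Z.of_nat (S n) - 1)%Z with (Z.of_nat n) by lia.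
Qed.

Lemma L_neg_S (n : nat) : L (- Z.of_nat (S n)) = (-1) ^ S n * IZR (lucas_nat (S n)).
Proof.
  unfold L, lucas. rewrite (proj2 (Z.leb_gt 0 (- Z.of_nat (S n)))) by lia.
  now rewrite Z.opp_involutive, Nat2Z.id, mult_IZR, pow_IZR.
Qed.

Lemma F_binet (j : Z) : F j = (powerRZ golden j - powerRZ golden_conj j) / sqrt 5.
Proof.
  destruct (Z_nat_or_neg_nat j) as [n [-> | ->]].
  - now rewrite F_of_nat, fib_nat_binet, <- !pow_powerRZ.
  - rewrite F_neg_S, fib_nat_binet, powerRZ_golden_neg, powerRZ_golden_conj_neg.
    rewrite <- (tech_pow_Rmult (-1) n). unfold Rdiv. ring.
Qed.

Lemma L_binet (j : Z) : L j = powerRZ golden j + powerRZ golden_conj j.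
Proof.
  destruct (Z_nat_or_neg_nat j) as [n [-> | ->]].
  - now rewrite L_of_nat, lucas_nat_binet, <- !pow_powerRZ.
  - rewrite L_neg_S, lucas_nat_binet, powerRZ_golden_neg, powerRZ_golden_conj_neg. ring.
Qed.

Lemma powerRZ_golden_conj_even (j : Z) (hj : Z.Even j) :
  powerRZ golden_conj j = powerRZ golden (- j).
Proof.
  destruct hj as [s ->]. rewrite powerRZ_neg', <- powerRZ_inv', Rinv_golden.
  assert (golden_conj <> 0).
  { intros E. pose proof golden_conj_sqr. rewrite E in *. lra. }
  rewrite <- Z.add_diag, !powerRZ_add, <- !powerRZ_mult by lra. f_equal. ring.
Qed.

Lemma powerRZ_mul_nat (x : R) (z : Z) (k : nat) (hx : x <> 0) :
  powerRZ x (z * Z.of_nat k) = powerRZ x z ^ k.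
Proof.
  induction k as [|k IHk].
  - now rewrite Z.mul_0_r.
  - rewrite Nat2Z.inj_succ, Z.mul_succ_r, powerRZ_add, IHk by assumption.
    simpl. ring.
Qed.

Lemma ln_powerRZ (x : R) (z : Z) (hx : 0 < x) : ln (powerRZ x z) = IZR z * ln x.
Proof. rewrite powerRZ_Rpower by assumption. apply ln_exp. Qed.

Section EvenMultiples.

Variables (r : Z) (hr : Z.Even r).

Lemma powerRZ_golden_conj_even_mul (k : nat) :
  powerRZ golden_conj (r * Z.of_nat k) = powerRZ golden (- r) ^ k.
Proof.
  pose proof golden_pos. rewrite powerRZ_golden_conj_even.
  - rewrite <- Z.mul_opp_l. apply powerRZ_mul_nat. lra.
  - destruct hr as [q ->]. exists (q * Z.of_nat k)%Z. ring.
Qed.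

Lemma F_even_mul (k : nat) :
  F (r * Z.of_nat k) = (powerRZ golden r ^ k - powerRZ golden (- r) ^ k) / sqrt 5.
Proof.
  pose proof golden_pos.
  now rewrite F_binet, powerRZ_golden_conj_even_mul, powerRZ_mul_nat by lra.
Qed.

Lemma L_even_mul (k : nat) :
  L (r * Z.of_nat k) = powerRZ golden r ^ k + powerRZ golden (- r) ^ k.
Proof.
  pose proof golden_pos.
  now rewrite L_binet, powerRZ_golden_conj_even_mul, powerRZ_mul_nat by lra.
Qed.

Lemma L_even : L r = powerRZ golden r + powerRZ golden (- r).
Proof. now rewrite L_binet, powerRZ_golden_conj_even. Qed.

End EvenMultiples.

Theorem theorem9 (r : Z) (n m : nat) (hr : Z.Even r) (hn : (0 < n)%nat) :
  (ex_series (fun k : nat =>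
      let j := (m + k)%nat in
      F (r * Z.of_nat (n + j)) / (L r ^ (n + j) * binom (n + j) j))
   /\
   (-1) ^ n / INR n
     * Series (fun k : nat =>
         let j := (m + k)%nat in
         F (r * Z.of_nat (n + j)) / (L r ^ (n + j) * binom (n + j) j))
   = sum_n_m (fun j : nat =>
         binom (n - 1) j
         * ((-1) ^ j * F (r * Z.of_nat (n - j - 1))
            / (INR j * L r ^ (n - j - 1) * binom (m + j) j))) 1 (n - 1)
     - sum_n_m (fun j : nat =>
         binom m j
         * ((-1) ^ j * F (r * Z.of_nat (n + j - 1))
            / (INR j * L r ^ (n + j - 1) * binom (n - 1 + j) j))) 1 m
     + F (r * Z.of_nat (n - 1)) / L r ^ (n - 1) * (H (n - 1) - H m)
     + 1 / L r ^ (n - 1)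
       * (F (r * Z.of_nat (n - 1)) * ln (L r)
          - IZR r * L (r * Z.of_nat (n - 1)) / sqrt 5 * ln golden))
  /\
  (ex_series (fun k : nat =>
      let j := (m + k)%nat in
      L (r * Z.of_nat (n + j)) / (L r ^ (n + j) * binom (n + j) j))
   /\
   (-1) ^ (n - 1) / INR n
     * Series (fun k : nat =>
         let j := (m + k)%nat in
         L (r * Z.of_nat (n + j)) / (L r ^ (n + j) * binom (n + j) j))
   = sum_n_m (fun j : nat =>
         binom (n - 1) j
         * ((-1) ^ j * L (r * Z.of_nat (n - j - 1))
            / (INR j * L r ^ (n - j - 1) * binom (m + j) j))) 1 (n - 1)
     - sum_n_m (fun j : nat =>
         binom m j
         * ((-1) ^ j * L (r * Z.of_nat (n + j - 1))
            / (INR j * L r ^ (n + j - 1) * binom (n - 1 + j) j))) 1 m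
     + L (r * Z.of_nat (n - 1)) / L r ^ (n - 1) * (H (n - 1) - H m)
     + 1 / L r ^ (n - 1)
       * (L (r * Z.of_nat (n - 1)) * ln (L r)
          - IZR r * F (r * Z.of_nat (n - 1)) * sqrt 5 * ln golden)).
Proof.
  pose proof golden_pos as Hg. pose proof sqrt5_pos as Hsqrt5.
  pose proof (powerRZ_lt golden r Hg) as Ha.
  pose proof (powerRZ_lt golden (- r) Hg) as Hb.
  assert (HF : forall k, F (r * Z.of_nat k)
      = / sqrt 5 * (powerRZ golden r ^ k + -1 * powerRZ golden (- r) ^ k))
    by (intros k; rewrite (F_even_mul r hr); unfold Rdiv; ring).
  assert (HL : forall k, L (r * Z.of_nat k)
      = 1 * (powerRZ golden r ^ k + 1 * powerRZ golden (- r) ^ k))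
    by (intros k; rewrite (L_even_mul r hr); ring).
  rewrite (L_even r hr). split.
  - destruct (Series_inv_binom_two_powers _ _ _ _ (-1) n m Ha Hb ltac:(ring) hn HF)
      as [Hex Hsum].
    split; [exact Hex|].
    rewrite inv_binom_sum_quot, !ln_powerRZ, opp_IZR, tech_pow_Rmult in Hsum by assumption.
    replace (S (n - 1)) with n in Hsum by lia.
    etransitivity; [exact Hsum|]. rewrite HL. unfold Rdiv. ring.
  - destruct (Series_inv_binom_two_powers _ _ _ _ 1 n m Ha Hb ltac:(ring) hn HL)
      as [Hex Hsum].
    split; [exact Hex|].
    rewrite inv_binom_sum_quot, !ln_powerRZ, opp_IZR, Rmult_1_l in Hsum by assumption.
    etransitivity; [exact Hsum|]. rewrite HF. f_equal. field.
    split; [|apply pow_nonzero]; lra.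
Qed.
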